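(* Let $p(x,y)=\sum c_{k,l}x^k y^l$ be a polynomial in two variables with real coefficients and let $C=\{(x,y)\in\mathbf{R}^2 : p(x,y)=0\}$, with the usual topology inherited from $\mathbf{R}^2$. Suppose that $C$ is compact. Then (1) $p$ is not divisible by $x$ or $y$ (that is, neither $x$ nor $y$ divides $p$), and (2) for every outer edge $E$ of the Newton polygon of $p$, the edge polynomial $e_E$ has no real zeroes of odd order (i.e. no real zeroes of odd multiplicity).
   Context: For $p(x,y)=\sum c_{k,l}x^k y^l\in\mathbf{R}[x,y]$ (finite sum over integers $k,l\ge 0$), set $N=\{(k,l)\in\mathbf{Z}^2 : c_{k,l}\neq 0\}$. The Newton polygon of $p$ is the convex hull of $N$ in $\mathbf{R}^2$. If the Newton polygon is a nondegenerate line segment, that segment itself counts as an edge; if it is a single point, there are no edges. Each edge $E$ is given an orientation, with initial endpoint $(k'_E,l'_E)$ and final endpoint $(k''_E,l''_E)$ (these are distinct points of $N$). Define $$d_E=\gcd(k''_E-k'_E,\ l''_E-l'_E),\qquad p_E=\frac{k''_E-k'_E}{d_E},\qquad q_E=\frac{l''_E-l'_E}{d_E},$$ and the edge polynomial $e_E\in\mathbf{R}[t]$ by $$e_E(t)=\sum_{i=0}^{d_E} c_{k'_E+ip_E,\ l'_E+iq_E}\,t^i,$$ where $c_{k,l}=0$ for $(k,l)\notin N$. (Either orientation of $E$ may be chosen.) An edge $E$ is called outer if there are real numbers $a,b$, at least one of which is positive, such that the linear function $(k,l)\mapsto ak+bl$ on the Newton polygon attains its maximum at every point of $E$. *)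

(* Defs.v *)
From HB Require Import structures.
From mathcomp Require Import all_boot all_order all_algebra.
From mathcomp Require Import all_classical all_reals all_analysis.

Set Implicit Arguments.
Unset Strict Implicit.
Unset Printing Implicit Defensive.

Import Order.TTheory GRing.Theory Num.Theory.
Import numFieldNormedType.Exports.

Local Open Scope classical_set_scope.
Local Open Scope ring_scope.
Local Open Scope convex_scope.

(* A polynomial p(x, y) is p : {poly {poly R}}, with x the outer variable 'X
   and y the inner variable 'Y, so that p`_k`_l is the coefficient of x^k y^l
   and p.[x, y] is its value at (x, y). *)

(* The library's pseudo-divisibility %| is not ring divisibility in
   {poly {poly R}}: it ignores nonzero factors from {poly R} such as 'Y. *)
Definition ring_divides (A : comNzRingType) (a b : A) : Prop :=
  exists q : A, b = q * a.

(* On pairs, compact refers to the product topology of R * R. *)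
Definition zero_locus (R : realType) (p : {poly {poly R}}) : set (R * R) :=
  [set z | p.[z.1, z.2] = 0].

Definition coefXY (R : realType) (p : {poly {poly R}}) (k l : int) : R :=
  match k, l with
  | Posz m, Posz n => p`_m`_n
  | _, _ => 0
  end.

Definition support_set (R : realType) (p : {poly {poly R}}) : set (int * int) :=
  [set u | coefXY p u.1 u.2 != 0].

Definition plane (R : realType) : Type := convex_lmodType (R^o * R^o)%type.

Definition lattice_point (R : realType) (u : int * int) : plane R :=
  (u.1%:~R, u.2%:~R).

Definition convex_hull (R : realType) (A : set (plane R)) : set (plane R) :=
  smallest (@convex_set R (R^o * R^o)%type) A.

Definition newton_polygon (R : realType) (p : {poly {poly R}}) :
    set (plane R) :=
  convex_hull (@lattice_point R @` support_set p).

Definition closed_segment (R : realType) (z w : plane R) :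
    set (plane R) :=
  range (fun t : {i01 R} => (z : convex_lmodType (R^o * R^o)%type) <| t |> w).

Definition linear_form (R : realType) (a b : R) (z : plane R) : R :=
  a * z.1 + b * z.2.

Definition maximizers (R : realType) (f : plane R -> R) (P : set (plane R)) :
    set (plane R) :=
  [set z | P z /\ forall w, P w -> f w <= f z].

(* An edge is a one-dimensional face, faces being cut out by nonzero linear
   forms. If P is itself a nondegenerate segment, a form orthogonal to it shows
   that P is an edge; if P is a point, there are none. *)
Definition is_edge (R : realType) (P E : set (plane R)) : Prop :=
  (exists a b : R, (a, b) != (0, 0) /\ E = maximizers (linear_form a b) P) /\
  (exists z w : plane R, z <> w /\ E = closed_segment z w).

Definition is_outer (R : realType) (P E : set (plane R)) : Prop :=
  exists a b : R, (0 < a \/ 0 < b) /\ E `<=` maximizers (linear_form a b) P.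

(* u is the initial and v the final endpoint of E. *)
Definition orientation (R : realType) (p : {poly {poly R}})
    (E : set (plane R)) (u v : int * int) : Prop :=
  [/\ support_set p u, support_set p v, u <> v &
      E = closed_segment (lattice_point R u) (lattice_point R v)].

Definition edge_poly (R : realType) (p : {poly {poly R}}) (u v : int * int) :
    {poly R} :=
  let d := gcdn `|v.1 - u.1|%N `|v.2 - u.2|%N in
  let pE := ((v.1 - u.1) %/ d%:Z)%Z in
  let qE := ((v.2 - u.2) %/ d%:Z)%Z in
  \poly_(i < d.+1) coefXY p (u.1 + i%:Z * pE) (u.2 + i%:Z * qE).

(* Main.v *)
Require Import Defs.
From mathcomp Require Import all_boot all_order all_algebra.
From mathcomp Require Import all_classical all_reals all_analysis.
From mathcomp Require Import ring lra zify.
Import Order.TTheory GRing.Theory Num.Theory.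
Import numFieldNormedType.Exports.
Local Open Scope classical_set_scope.
Local Open Scope ring_scope.

(** The idea is to follow the polynomial along the monomial curves pointing out
    of an outer edge.  Let E be an outer edge with primitive direction (P, Q).
    Some outer normal of E is a positive multiple of (A, B) = (Q, -P) or (-Q, P), an
    integer vector with a positive entry.  Substituting x s^A and y s^B for the
    variables multiplies the monomial of exponent (k, l) by s^(A k + B l), so
    as s tends to infinity the value of p has the sign of its initial form (the
    sum of the monomials of maximal weight A k + B l) where that is nonzero
    ([initial_form_dominates]).  Those monomials are the ones on E, and for
    nonzero x and y the initial form equals x^u1 y^u2 e(x^P y^Q), where u is
    the initial endpoint of E and e its edge polynomial
    ([outer_edge_weight], [initial_form_edge]).

    A real zero t of odd order of e is nonzero, because e(0) is the nonzero
    coefficient at u; hence e takes opposite signs at two points t1, t2 of the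
    same sign as t ([odd_root_sign_change]).  One of the coprime integers P, Q
    is odd, so t1 and t2 are values of x^P y^Q at two points of one open
    quadrant ([monomial_curve_points]); there x^u1 y^u2 has a single sign, and
    the initial form takes opposite signs.  For all large s the polynomial p
    then takes opposite signs at the two scaled points, so it vanishes on the
    segment between them ([zero_between]).  That segment stays in the quadrant,
    at a distance from one of the axes that grows with s, since A or B is
    positive.  The zero locus is therefore unbounded
    ([compact_initial_form_sign]).

    If x or y divides p, the zero locus contains a whole coordinate axis. *)

Set Implicit Arguments.
Unset Strict Implicit.

(** * Zeros between two points of an open quadrant *)

Section SignChange.
Variable R : realType.
Implicit Types (p : {poly {poly R}}) (e : {poly R}).

(** The modulus is monotone on a segment that does not meet 0. *)
Lemma segment_away_from_zero (a b t : R) : 0 < a * b -> 0 <= t <= 1 ->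
  `|a| <= `|a + t * (b - a)| \/ `|b| <= `|a + t * (b - a)|.
Proof.
wlog a0 : a b / 0 < a => [hw|] ab /andP[t0 t1].
  have [a0|a0|a0] := ltgtP 0 a; first by apply: hw => //; rewrite t0.
    have := hw (- a) (- b); rewrite oppr_gt0 mulrNN t0 => /(_ a0 ab t1).
    by rewrite !normrN -opprD mulrN -opprD normrN.
  by move: ab; rewrite -a0 mul0r ltxx.
have b0 : 0 < b by rewrite -(pmulr_rgt0 _ a0).
have [ab'|ba] := leP a b; [left|right].
  by rewrite !ger0_norm; nra.
by rewrite !ger0_norm; nra.
Qed.

Lemma horner_along p (f g : {poly R}) (t : R) :
  (map_poly (comp_poly g) p).[f].[t] = p.[f.[t], g.[t]].
Proof.
elim/poly_ind: p => [|p c IH]; first by rewrite rmorph0 !horner0.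
rewrite rmorphD rmorphM /= map_polyX map_polyC /=.
by rewrite !hornerE /= IH horner_comp.
Qed.

(** Restricting p to the segment turns the claim into the intermediate value
    theorem for a univariate polynomial; both coordinates keep their sign along
    the segment, which gives the lower bounds. *)
Lemma zero_between p x1 y1 x2 y2 :
  0 < x1 * x2 -> 0 < y1 * y2 -> p.[x1, y1] * p.[x2, y2] < 0 ->
  exists x y, [/\ p.[x, y] = 0, `|x1| <= `|x| \/ `|x2| <= `|x|
                & `|y1| <= `|y| \/ `|y2| <= `|y|].
Proof.
wlog p1 : x1 y1 x2 y2 / p.[x1, y1] <= 0 => [hw|] x12 y12 p12.
  have [p1|p1] := leP p.[x1, y1] 0; first exact: hw.
  have p2 : p.[x2, y2] <= 0 by rewrite ltW// -(pmulr_rlt0 _ p1).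
  have [||||x [y [pxy hx hy]]] // := hw x2 y2 x1 y1; rewrite 1?mulrC//.
  by exists x, y; split => //; tauto.
have p2 : 0 <= p.[x2, y2] by nra.
pose f (a b : R) : {poly R} := a%:P + 'X * (b - a)%:P.
have fE a b t : (f a b).[t] = a + t * (b - a) by rewrite !hornerE.
pose r := (map_poly (comp_poly (f y1 y2)) p).[f x1 x2].
have rE t : r.[t] = p.[x1 + t * (x2 - x1), y1 + t * (y2 - y1)].
  by rewrite horner_along !fE.
have := @poly_ivt R r 0 1 ler01.
rewrite !rE !mul0r !mul1r !addr0 ![_ + (_ - _)]addrC !subrK p1 p2.
move=> /(_ isT)[t t01 /rootP]; rewrite rE => rt.
exists (x1 + t * (x2 - x1)), (y1 + t * (y2 - y1)).
by split => //; exact: segment_away_from_zero.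
Qed.

Lemma odd_power_root (n : int) (t : R) : odd `|n| -> t != 0 ->
  exists2 x : R, x ^ n = t & 0 < x * t.
Proof.
have nat_root (m : nat) (z : R) : odd m -> 0 < z ->
    exists2 x : R, x ^+ m = z & 0 < x.
  move=> om z0; exists (z `^ m%:R^-1); last exact: powR_gt0.
  rewrite -powR_mulrn ?powR_ge0// -powRrM mulVf ?powRr1// ?ltW//.
  by rewrite pnatr_eq0; case: m om.
have nat_root' (m : nat) (z : R) : odd m -> z != 0 ->
    exists2 x : R, x ^+ m = z & 0 < x * z.
  move=> om; rewrite neq_lt => /orP[z0|z0].
    have [|x xm x0] := nat_root m (- z) om; first by rewrite oppr_gt0.
    by exists (- x); [rewrite exprNn -signr_odd om mulN1r xm opprK | nra].
  by have [x xm x0] := nat_root m z om z0; exists x => //; nra.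
case: n => [m|m] on t0; first exact: nat_root'.
have [||x xm xt] := nat_root' m.+1 t^-1; rewrite ?invr_eq0//.
exists x; first by rewrite NegzE -exprnN xm invrK.
have tV2 : 0 < t^-1 ^+ 2 by rewrite exprn_even_gt0 ?invr_eq0.
rewrite -(pmulr_lgt0 _ tV2); suff -> : x * t * t^-1 ^+ 2 = x * t^-1 by [].
by field.
Qed.

(** Near t the cofactor of ('X - t)^m keeps its sign, whereas ('X - t)^m changes
    sign at t when m is odd. *)
Lemma odd_root_sign_change e t : e != 0 -> t != 0 -> odd (mup t e) ->
  exists t1 t2, [/\ 0 < t1 * t, 0 < t2 * t & e.[t1] * e.[t2] < 0].
Proof.
move=> e0 t0; have [m [g + eE]] := multiplicity_XsubC e t.
rewrite e0 /= => gt; rewrite {1}eE mupMr// mup_XsubCX eqxx => om.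
have g2 : 0 < g.[t] * g.[t] by rewrite -expr2 exprn_even_gt0//; exact: gt.
have : \forall z \near t, 0 < g.[z] * g.[t].
  have c : (fun z => g.[z] * g.[t]) z @[z --> t] --> g.[t] * g.[t].
    by apply: cvgMl; exact: continuous_horner.
  by apply: (cvgr_gt _ c).
move=> /nbhs_ballP[d /= d0 dB].
have n0 : 0 < `|t| by rewrite normr_gt0.
(* Below d, so that g keeps its sign; below |t|, so that t - h and t + h have the
   sign of t. *)
pose h := Num.min (d / 2) (`|t| / 2).
have h0 : 0 < h by rewrite lt_min !divr_gt0.
have hd : h < d by rewrite gt_min; apply/orP; left; lra.
have ht : h < `|t| by rewrite gt_min; apply/orP; right; lra.
have g1 : 0 < g.[t - h] * g.[t].
  by apply: dB; rewrite /ball /= opprB addrC subrK gtr0_norm.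
have g1' : 0 < g.[t + h] * g.[t].
  by apply: dB; rewrite /ball /= opprD addrA subrr sub0r normrN gtr0_norm.
have tt : `|t| * `|t| = t * t by rewrite -!expr2 real_normK ?num_real.
have hh : h * `|t| < `|t| * `|t| by rewrite ltr_pM2r.
have th : `|h * t| < t * t by rewrite -tt normrM gtr0_norm.
move: th; rewrite ltr_norml => /andP[th1 th2].
exists (t - h), (t + h); split; [nra|nra|].
rewrite eE !hornerE.
have -> : t - h - t = - h by ring.
have -> : t + h - t = h by ring.
rewrite exprNn -signr_odd om mulN1r.
have gg : 0 < g.[t - h] * g.[t + h].
  rewrite -(pmulr_lgt0 _ g2).
  by rewrite mulrACA mulr_gt0.
have hm : 0 < h ^+ m by rewrite exprn_gt0.
rewrite [ltLHS](_ : _ = - (g.[t - h] * g.[t + h] * (h ^+ m * h ^+ m))).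
  by rewrite oppr_lt0 (mulr_gt0 gg (mulr_gt0 hm hm)).
by rewrite /=; ring.
Qed.

(** One of P and Q is odd: its variable is an odd root of t1 or t2, the other
    variable is 1. *)
Lemma monomial_curve_points (P Q : int) (t1 t2 : R) : coprimez P Q ->
  0 < t1 * t2 ->
  exists x1 y1 x2 y2, [/\ 0 < x1 * x2, 0 < y1 * y2,
    x1 ^ P * y1 ^ Q = t1 & x2 ^ P * y2 ^ Q = t2].
Proof.
move=> cPQ t12.
have [t1n0 t2n0] : t1 != 0 /\ t2 != 0.
  by apply/andP; rewrite -negb_or -mulf_eq0 gt_eqF.
have roots (n : int) : odd `|n| ->
    exists x1 x2 : R, [/\ 0 < x1 * x2, x1 ^ n = t1 & x2 ^ n = t2].
  move=> on; have [x1 e1 s1] := odd_power_root on t1n0.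
  have [x2 e2 s2] := odd_power_root on t2n0.
  exists x1, x2; split => //.
  by rewrite -(pmulr_lgt0 _ t12) mulrACA mulr_gt0.
have [oP|eP] := boolP (odd `|P|).
  have [x1 [x2 [x12 e1 e2]]] := roots _ oP.
  by exists x1, 1, x2, 1; split; rewrite ?exp1rz ?mulr1.
have oQ : odd `|Q|.
  apply: contraT => eQ; move: cPQ; rewrite /coprimez /gcdz eqz_nat => /eqP g1.
  by have := dvdn_gcd 2 `|P| `|Q|; rewrite !dvdn2 eP eQ g1.
have [y1 [y2 [y12 e1 e2]]] := roots _ oQ.
by exists 1, y1, 1, y2; split; rewrite ?exp1rz ?mul1r.
Qed.

End SignChange.

(** * Weights and initial forms *)

Section InitialForm.
Variable R : realType.
Implicit Types (p : {poly {poly R}}) (x y s : R) (w : int * int).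

(** Exponents are integers because the direction (P, Q) of an edge, and the
    exponents A and B of the curves, may be negative. *)
Definition monomial_value p x y w : R := coefXY p w.1 w.2 * x ^ w.1 * y ^ w.2.

(** The exponents in a rectangle that contains the support, so that sums over
    the support become sums over a finite type. *)
Definition box p : finType := ('I_(size p) * 'I_(sizeY p))%type.

Definition exponent p (z : box p) : int * int := (z.1%:Z, z.2%:Z).

Lemma horner2E p x y :
  p.[x, y] = \sum_(z : box p) monomial_value p x y (exponent z).
Proof.
rewrite [p.[_]]horner_coef horner_sum.
transitivity (\sum_(k < size p) \sum_(l < sizeY p)
    monomial_value p x y (k%:Z, l%:Z)); last first.
  by rewrite pair_bigA.
apply: eq_bigr => k _.
rewrite hornerM -polyC_exp hornerC.
rewrite (horner_coef_wide _ (max_size_coefXY p k)) big_distrl /=.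
by apply: eq_bigr => l _; rewrite /monomial_value /= mulrAC.
Qed.

Lemma support_exponent p w :
  coefXY p w.1 w.2 != 0 -> exists z : box p, w = exponent z.
Proof.
case: w => -[k|k] [l|l] /=; rewrite ?eqxx // => c0.
have kp : (k < size p)%N.
  by rewrite ltnNge; apply: contra c0 => /(nth_default 0) ->; rewrite coef0.
have lp : (l < sizeY p)%N.
  rewrite ltnNge; apply: contra c0 => /(leq_trans (max_size_coefXY p k)).
  by move=> /(nth_default 0) ->.
by exists (Ordinal kp, Ordinal lp).
Qed.

Lemma exponent_inj p : injective (@exponent p).
Proof.
move=> [k l] [k' l'] [/= e1 e2]; congr pair; exact: val_inj.
Qed.

Definition weight (A B : int) w : int := A * w.1 + B * w.2.

Definition initial_form p A B (M : int) x y : R :=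
  \sum_(z : box p | weight A B (exponent z) == M)
     monomial_value p x y (exponent z).

Lemma monomial_value_scale p A B x y s w : s != 0 ->
  monomial_value p (x * s ^ A) (y * s ^ B) w =
  s ^ weight A B w * monomial_value p x y w.
Proof.
move=> s0; rewrite /monomial_value /weight !expfzMl !exprz_exp expfzDr //.
ring.
Qed.

(** After division by s^M, every monomial of weight below M carries a factor
    s^(-1) at least, so all of them together are O(1/s) and cannot change the
    sign of the nonzero constant contributed by the initial form. *)
Lemma initial_form_dominates p A B M x y :
  (forall w, coefXY p w.1 w.2 != 0 -> weight A B w <= M) ->
  initial_form p A B M x y != 0 ->
  \forall s \near +oo,
    0 < initial_form p A B M x y * p.[x * s ^ A, y * s ^ B].
Proof.
move=> wM; set F := initial_form _ _ _ _ _ _ => F0.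
pose K := \sum_(z : box p) `|monomial_value p x y (exponent z)|.
near=> s.
have s1 : 1 <= s by near: s; apply: nbhs_pinfty_ge; rewrite num_real.
have s0 : 0 < s by apply: lt_le_trans s1.
(* This bound on s makes K / s, which dominates the other monomials, less than |F|. *)
have sK : K / `|F| < s by near: s; apply: nbhs_pinfty_gt; rewrite num_real.
pose G := \sum_(z : box p | weight A B (exponent z) != M)
  s ^ (weight A B (exponent z) - M) * monomial_value p x y (exponent z).
have pE : p.[x * s ^ A, y * s ^ B] = s ^ M * (F + G).
  rewrite horner2E (bigID (fun z => weight A B (exponent z) == M)) /=.
  rewrite mulrDr !big_distrr /=; congr (_ + _).
    by apply: eq_bigr => z /eqP zM; rewrite monomial_value_scale ?gt_eqF// zM.
  apply: eq_bigr => z _; rewrite monomial_value_scale ?gt_eqF//.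
  by rewrite mulrA -expfzDr ?gt_eqF// addrC subrK.
have GF : `|G| < `|F|.
  apply: (@le_lt_trans _ _ (K / s)); last first.
    by rewrite ltr_pdivrMr// mulrC -ltr_pdivrMr// normr_gt0.
  rewrite (le_trans (ler_norm_sum _ _ _))// /K big_distrl/=.
  rewrite [leRHS](bigID (fun z => weight A B (exponent z) == M)) /=.
  rewrite ler_wpDl//; first by apply: sumr_ge0 => z _; rewrite divr_ge0// ltW.
  apply: ler_sum => z zM.
  have [c0|c0] := eqVneq (coefXY p (exponent z).1 (exponent z).2) 0.
    by rewrite /monomial_value c0 !mul0r mulr0 normr0 mul0r.
  rewrite normrM mulrC ler_wpM2l// ger0_norm ?exprz_ge0 ?(ltW s0)//.
  have : weight A B (exponent z) - M <= -1 by move: (wM _ c0) zM; lia.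
  have -> : s^-1 = s ^ (-1 : int) by [].
  exact: (@ler_weXz2l R s s1).
rewrite pE mulrCA mulr_gt0 ?exprz_gt0// mulrDr.
have : `|F * G| < F * F.
  rewrite normrM -[F * F]ger0_norm -?expr2 ?sqr_ge0//.
  by rewrite expr2 normrM ltr_pM2l// normr_gt0.
by rewrite ltr_norml => /andP[+ _]; rewrite -subr_gt0 opprK addrC.
Unshelve. all: by end_near. Qed.

End InitialForm.

(** * Lattice points of an outer edge *)

Section Edge.
Variable R : realType.
Implicit Types (p : {poly {poly R}}) (u v w : int * int) (E : set (plane R)).

(** These are the integers d, P and Q of the definition of the edge polynomial:
    (m, n) is d times the primitive vector (P, Q). *)
Lemma primitive_direction (m n : int) (d := gcdn `|m| `|n|) :
  (m, n) <> (0, 0) ->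
  [/\ (0 < d)%N, m = d%:Z * (m %/ d%:Z)%Z, n = d%:Z * (n %/ d%:Z)%Z
    & coprimez (m %/ d%:Z)%Z (n %/ d%:Z)%Z].
Proof.
move=> mn0.
have d0 : (0 < d)%N.
  rewrite gcdn_gt0 !absz_gt0; apply/norP => -[/negPn/eqP m0 /negPn/eqP n0].
  by apply: mn0; rewrite m0 n0.
have mE : m = d%:Z * (m %/ d%:Z)%Z by rewrite mulrC divzK// dvdz_gcdl.
have nE : n = d%:Z * (n %/ d%:Z)%Z by rewrite mulrC divzK// dvdz_gcdr.
split => //.
rewrite /coprimez /gcdz eqz_nat -(eqn_pmul2l d0) muln1.
by rewrite muln_gcdr -!(abszM d%:Z) -mE -nE.
Qed.

Lemma displacement_neq0 u v : u <> v -> (v.1 - u.1, v.2 - u.2) <> (0, 0).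
Proof.
case: u v => [u1 u2] [v1 v2] /= uv [h1 h2]; apply: uv.
by congr pair; apply/esym/eqP; rewrite -subr_eq0; apply/eqP.
Qed.

(** With x P + y Q = 1, the multiplier is y a - x b. *)
Lemma coprime_orthogonal (P Q : int) (a b : R) :
  coprimez P Q -> a * P%:~R + b * Q%:~R = 0 ->
  exists m, a = m * Q%:~R /\ b = - m * P%:~R.
Proof.
move=> /coprimezP[[x y] /= xy] ab.
have xyR : x%:~R * P%:~R + y%:~R * Q%:~R = 1 :> R by rewrite -!intrM -intrD xy.
exists (y%:~R * a - x%:~R * b).
split.
  transitivity (a * (x%:~R * P%:~R + y%:~R * Q%:~R)
    - x%:~R * (a * P%:~R + b * Q%:~R)); last by ring.
  by rewrite xyR ab mulr1 mulr0 subr0.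
transitivity (b * (x%:~R * P%:~R + y%:~R * Q%:~R)
  - y%:~R * (a * P%:~R + b * Q%:~R)); last by ring.
by rewrite xyR ab mulr1 mulr0 subr0.
Qed.

(** An integer point at parameter s of the segment is u + s d (P, Q), and s d is
    an integer because it is an integer combination of the coordinates, by
    Bezout's identity for P and Q. *)
Lemma lattice_points_of_segment u v w (d := gcdn `|v.1 - u.1| `|v.2 - u.2|) :
  u <> v ->
  closed_segment (lattice_point R u) (lattice_point R v)
    (lattice_point R w) ->
  exists2 i : nat, (i <= d)%N &
    w = (u.1 + i%:Z * ((v.1 - u.1) %/ d%:Z)%Z,
         u.2 + i%:Z * ((v.2 - u.2) %/ d%:Z)%Z).
Proof.
move=> uv [t _ [e1 e2]].
have [] := primitive_direction (displacement_neq0 uv).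
rewrite -/d; move: (_ %/ _)%Z (_ %/ _)%Z => Q P d0 eP eQ /coprimezP[[x y] /= xy].
(* The convex combination gives the weight t to its left argument u. *)
pose s : R := 1 - t%:num.
have s01 : 0 <= s <= 1.
  by rewrite subr_ge0 gerBl; apply/andP.
have d0R : 0 < d%:R :> R by rewrite ltr0n.
have {}e1 : (1 - s) * u.1%:~R + s * v.1%:~R = w.1%:~R by rewrite -[RHS]e1 /s subKr.
have {}e2 : (1 - s) * u.2%:~R + s * v.2%:~R = w.2%:~R by rewrite -[RHS]e2 /s subKr.
have {}e1 : (w.1 - u.1)%:~R = s * (d%:R * P%:~R) :> R.
  rewrite -[d%:R]/(d%:~R) -intrM -eP !intrB -e1; ring.
have {}e2 : (w.2 - u.2)%:~R = s * (d%:R * Q%:~R) :> R.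
  rewrite -[d%:R]/(d%:~R) -intrM -eQ !intrB -e2; ring.
pose i := x * (w.1 - u.1) + y * (w.2 - u.2).
have iE : i%:~R = s * d%:R :> R.
  have xyR : x%:~R * P%:~R + y%:~R * Q%:~R = 1 :> R by rewrite -!intrM -intrD xy.
  rewrite intrD !intrM e1 e2.
  transitivity (s * d%:R * (x%:~R * P%:~R + y%:~R * Q%:~R)); first by ring.
  by rewrite xyR mulr1.
have i0 : 0 <= i.
  by rewrite -(ler0z R) iE mulr_ge0 ?(ltW d0R)//; case/andP: s01.
have id : i <= d%:Z.
  by rewrite -(ler_int R) iE ler_piMl ?(ltW d0R)//; case/andP: s01.
have iP : w.1 - u.1 = i * P.
  by apply/(@intr_inj R); rewrite intrM iE e1 mulrA.
have iQ : w.2 - u.2 = i * Q.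
  by apply/(@intr_inj R); rewrite intrM iE e2 mulrA.
exists `|i|%N; first lia.
by rewrite gez0_abs// -iP -iQ; case: (w) => w1 w2 /=; congr pair; ring.
Qed.

Lemma lattice_point_newton p w :
  support_set p w -> newton_polygon p (lattice_point R w).
Proof. by move=> pw; apply: sub_gen_smallest; exists w. Qed.

(** Both the linear form that cuts out E and the one that shows E to be outer
    are constant on E, hence multiples of (Q, -P).  A point of the polygon with
    the maximal value of the second form thus has the maximal value of the
    first one, whatever the sign of the ratio, and lies on E. *)
Lemma outer_edge_weight p E u v (d := gcdn `|v.1 - u.1| `|v.2 - u.2|)
    (P := ((v.1 - u.1) %/ d%:Z)%Z) (Q := ((v.2 - u.2) %/ d%:Z)%Z) :
  is_edge (newton_polygon p) E -> is_outer (newton_polygon p) E ->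
  orientation p E u v ->
  exists A B : int, [/\ 0 < A \/ 0 < B, A * P + B * Q = 0,
    forall w, support_set p w -> weight A B w <= weight A B u &
    forall w, support_set p w -> weight A B w = weight A B u ->
      exists2 i : nat, (i <= d)%N & w = (u.1 + i%:Z * P, u.2 + i%:Z * Q)].
Proof.
move=> [[a0 [b0 [_ Emax]]] _] [a [b [ab Eab]]] [pu pv uv Eseg].
have [] := primitive_direction (displacement_neq0 uv).
rewrite -/d -/P -/Q => d0 eP eQ cPQ.
have Eu : E (lattice_point R u) by rewrite Eseg; exists 1%:i01 => //; rewrite conv1.
have Ev : E (lattice_point R v) by rewrite Eseg; exists 0%:i01 => //; rewrite conv0.
have orth a' b' : E `<=` maximizers (linear_form a' b') (newton_polygon p) ->
    exists m, a' = m * Q%:~R /\ b' = - m * P%:~R.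
  move=> Em; apply: coprime_orthogonal => //.
  have [Nu fu] := Em _ Eu; have [Nv fv] := Em _ Ev.
  have /eqP : linear_form a' b' (lattice_point R v) =
      linear_form a' b' (lattice_point R u).
    by apply/eqP; rewrite eq_le fu// fv.
  rewrite /linear_form /= -subr_eq0 => /eqP h.
  have d0R : d%:R != 0 :> R by rewrite pnatr_eq0 -lt0n.
  apply: (mulfI d0R); rewrite mulr0 -[RHS]h.
  have -> : v.1 = u.1 + d%:Z * P by rewrite -eP; ring.
  have -> : v.2 = u.2 + d%:Z * Q by rewrite -eQ; ring.
  by rewrite !intrD !intrM; ring.
have [m [am bm]] := orth _ _ Eab.
have [m0 [am0 bm0]] : exists m, a0 = m * Q%:~R /\ b0 = - m * P%:~R.
  by apply: orth; rewrite Emax.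
have mn0 : m != 0.
  by apply/eqP => m00; move: ab; rewrite am bm m00 oppr0 !mul0r ltxx; case.
have nm0 : 0 < `|m| by rewrite normr_gt0.
(* (a, b) = |m| (e Q, - e P), where e = 1 or e = -1 is the sign of m. *)
have [e mE] : exists e : int, m = `|m| * e%:~R.
  by exists (sgz m); rewrite mulrC -sgrEz -numEsg.
have formE w : linear_form a b (lattice_point R w) =
    `|m| * (weight (e * Q) (- e * P) w)%:~R.
  by rewrite /linear_form /weight /= am bm {1 2}mE intrD !intrM intrN; ring.
exists (e * Q), (- e * P); split.
- move: ab; rewrite am bm mE -mulrN -!mulrA !(pmulr_rgt0 _ nm0).
  by rewrite -intrN -!intrM !ltr0z.
- ring.
- move=> w pw; have [_ /(_ _ (lattice_point_newton pw))] := Eab _ Eu.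
  by rewrite !formE (ler_pM2l nm0) ler_int.
move=> w pw ww; apply: lattice_points_of_segment => //; rewrite -Eseg.
have := Eu; rewrite Emax => -[_ maxu]; split; first exact: lattice_point_newton.
suff -> : linear_form a0 b0 (lattice_point R w) =
    linear_form a0 b0 (lattice_point R u) by [].
have e0 : e != 0 by apply: contra mn0 => /eqP e0; rewrite mE e0 mulr0.
have {}ww : Q * w.1 - P * w.2 = Q * u.1 - P * u.2.
  apply: (mulfI e0); transitivity (weight (e * Q) (- e * P) w).
    by rewrite /weight; ring.
  by rewrite ww /weight; ring.
have := congr1 (fun z : int => m0 * z%:~R) ww.
rewrite !intrB !intrM => wwR; rewrite /linear_form /= am0 bm0.
transitivity (m0 * (Q%:~R * w.1%:~R - P%:~R * w.2%:~R)); first by ring.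
by rewrite wwR; ring.
Qed.

(** The exponents of maximal weight are the u + i (P, Q) with i <= d, and the
    i-th of these monomials is its coefficient times
    x^u1 y^u2 (x^P y^Q)^i. *)
Lemma initial_form_edge p u v (d := gcdn `|v.1 - u.1| `|v.2 - u.2|)
    (P := ((v.1 - u.1) %/ d%:Z)%Z) (Q := ((v.2 - u.2) %/ d%:Z)%Z) A B x y :
  u <> v -> A * P + B * Q = 0 ->
  (forall w, support_set p w -> weight A B w = weight A B u ->
      exists2 i : nat, (i <= d)%N & w = (u.1 + i%:Z * P, u.2 + i%:Z * Q)) ->
  x != 0 -> y != 0 ->
  initial_form p A B (weight A B u) x y =
  x ^ u.1 * y ^ u.2 * (edge_poly p u v).[x ^ P * y ^ Q].
Proof.
move=> uv AB face x0 y0.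
have [] := primitive_direction (displacement_neq0 uv).
rewrite -/d -/P -/Q => d0 eP eQ cPQ.
pose W (i : nat) := (u.1 + i%:Z * P, u.2 + i%:Z * Q).
have PQ0 : (P != 0) || (Q != 0).
  apply/norP => -[/negPn/eqP h1 /negPn/eqP h2].
  by move: cPQ; rewrite h1 h2.
have W_inj : injective W.
  move=> i j [/addrI h1 /addrI h2].
  by case/orP: PQ0 => /mulIf h; [move: h1|move: h2] => /h [].
have weightW i : weight A B (W i) = weight A B u.
  transitivity (weight A B u + i%:Z * (A * P + B * Q)); last by rewrite AB mulr0 addr0.
  by rewrite /weight /W /=; ring.
transitivity (\sum_(i < d.+1) monomial_value p x y (W i)); last first.
  rewrite horner_poly mulr_sumr; apply: eq_bigr => i _.
  rewrite /monomial_value /W /= -/d -/P -/Q !expfzDr//.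
  rewrite ![i%:Z * _]mulrC -!exprz_exp -!exprnP exprMn. ring.
(* The inner sum has one term if the coefficient at u + i (P, Q) is nonzero;
   otherwise all its terms, if any, are 0. *)
transitivity (\sum_(i < d.+1) \sum_(z : box p | exponent z == W i)
    monomial_value p x y (exponent z)); last first.
  apply: eq_bigr => i _.
  have [c0|c0] := eqVneq (coefXY p (W i).1 (W i).2) 0.
    rewrite {2}/monomial_value c0 !mul0r big1// => z /eqP zW.
    by rewrite /monomial_value zW c0 !mul0r.
  have [z0 Wz0] := support_exponent c0.
  rewrite Wz0 (big_pred1 z0)// => z /=; exact/(inj_eq (@exponent_inj _ p)).
rewrite (exchange_big_dep (fun=> true))//= /initial_form big_mkcond/=.
apply: eq_bigr => z _.
have [c0|c0] := eqVneq (coefXY p (exponent z).1 (exponent z).2) 0.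
  rewrite /monomial_value c0 !mul0r if_same.
  by rewrite big1.
case: ifPn => [/eqP zu|zu]; last first.
  by rewrite big_pred0// => i; apply/negbTE; apply: contra zu => /eqP ->; rewrite weightW.
have [i id zi] := face _ c0 zu.
rewrite (big_pred1 (Ordinal (id : (i < d.+1)%N)))// => j /=.
by rewrite zi -[(_, _)]/(W i) (inj_eq W_inj) eq_sym.
Qed.

Lemma edge_poly0 p u v : (edge_poly p u v).[0] = coefXY p u.1 u.2.
Proof. by rewrite horner_coef0 coef_poly /= !mul0r !addr0. Qed.

End Edge.

(** * Compact zero loci *)

Section Compact.
Variable R : realType.
Implicit Types p : {poly {poly R}}.

Lemma compact_zero_locus_bounded p : compact (zero_locus p) ->
  exists M : R, forall x y, p.[x, y] = 0 -> `|x| <= M /\ `|y| <= M.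
Proof.
move=> cp.
have bnd (f : R * R -> R) : continuous f ->
    exists M, forall z, p.[z.1, z.2] = 0 -> `|f z| <= M.
  move=> cf.
  have /compact_bounded : compact (f @` zero_locus p).
    by apply: continuous_compact => //; exact: continuous_subspaceT.
  move=> [M [_ Mf]]; exists (M + 1) => z pz.
  by apply: (Mf (M + 1)); [rewrite ltrDl | exists z].
have [M1 M1P] := bnd fst (fun z => cvg_fst).
have [M2 M2P] := bnd snd (fun z => cvg_snd).
exists (Num.max M1 M2) => x y pxy; rewrite !le_max.
by rewrite (M1P (x, y) pxy) (M2P (x, y) pxy) orbT.
Qed.

Lemma scaled_escapes (A : int) (x M : R) : 0 < A -> x != 0 ->
  \forall s \near +oo, M < `|x * s ^ A|.
Proof.
move=> A0 x0; near=> s.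
have s1 : 1 <= s by near: s; apply: nbhs_pinfty_ge; rewrite num_real.
have s0 : 0 < s by apply: lt_le_trans s1.
have sK : M / `|x| < s by near: s; apply: nbhs_pinfty_gt; rewrite num_real.
have sA : s <= s ^ A by rewrite -{1}[s]expr1z; apply: (ler_weXz2l s1); lia.
rewrite normrM [`|s ^ _|]ger0_norm ?exprz_ge0 ?(ltW s0)//.
rewrite mulrC -ltr_pdivrMr ?normr_gt0//.
exact: lt_le_trans sA.
Unshelve. all: by end_near. Qed.

(** Were the two values of opposite signs, p would vanish, for every large s,
    somewhere between the points (x1 s^A, y1 s^B) and (x2 s^A, y2 s^B), hence
    arbitrarily far away. *)
Lemma compact_initial_form_sign p A B M x1 y1 x2 y2 :
  compact (zero_locus p) -> 0 < A \/ 0 < B ->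
  (forall w, support_set p w -> weight A B w <= M) ->
  0 < x1 * x2 -> 0 < y1 * y2 ->
  0 <= initial_form p A B M x1 y1 * initial_form p A B M x2 y2.
Proof.
move=> /compact_zero_locus_bounded[K KP] AB wM x12 y12; rewrite leNgt; apply/negP.
set F1 := initial_form _ _ _ _ _ _; set F2 := initial_form _ _ _ _ _ _ => F12.
have F1n0 : F1 != 0 by apply/eqP => F10; move: F12; rewrite F10 mul0r ltxx.
have F2n0 : F2 != 0 by apply/eqP => F20; move: F12; rewrite F20 mulr0 ltxx.
have [x1n0 x2n0] : x1 != 0 /\ x2 != 0.
  by apply/andP; rewrite -negb_or -mulf_eq0 gt_eqF.
have [y1n0 y2n0] : y1 != 0 /\ y2 != 0.
  by apply/andP; rewrite -negb_or -mulf_eq0 gt_eqF.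
have escapes : \forall s \near (pinfty_nbhs R),
    K < `|x1 * s ^ A| /\ K < `|x2 * s ^ A| \/
    K < `|y1 * s ^ B| /\ K < `|y2 * s ^ B|.
  case: AB => [A0|B0]; near=> s.
    by left; split; near: s; exact: scaled_escapes.
  by right; split; near: s; exact: scaled_escapes.
have : \forall s \near (pinfty_nbhs R), False; last first.
  by move=> /filter_ex [].
near=> s.
have s0 : 0 < s by near: s; apply: nbhs_pinfty_gt; rewrite num_real.
have p1 : 0 < F1 * p.[x1 * s ^ A, y1 * s ^ B].
  by near: s; exact: initial_form_dominates.
have p2 : 0 < F2 * p.[x2 * s ^ A, y2 * s ^ B].
  by near: s; exact: initial_form_dominates.
have p12 : p.[x1 * s ^ A, y1 * s ^ B] * p.[x2 * s ^ A, y2 * s ^ B] < 0.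
  by rewrite -(nmulr_rgt0 _ F12) mulrACA; apply: mulr_gt0.
have same_sign a b (C : int) : 0 < a * b -> 0 < (a * s ^ C) * (b * s ^ C).
  by move=> ab; rewrite mulrACA (mulr_gt0 ab)// mulr_gt0// exprz_gt0.
have [x [y [pxy hx hy]]] := zero_between (same_sign _ _ _ x12) (same_sign _ _ _ y12) p12.
have [xK yK] := KP _ _ pxy.
have [] : K < `|x1 * s ^ A| /\ K < `|x2 * s ^ A| \/
    K < `|y1 * s ^ B| /\ K < `|y2 * s ^ B| by near: s.
  by move=> [h1 h2]; case: hx => h; have := le_trans h xK; rewrite leNgt ?h1 ?h2.
by move=> [h1 h2]; case: hy => h; have := le_trans h yK; rewrite leNgt ?h1 ?h2.
Unshelve. all: by end_near. Qed.

Lemma compact_not_div p : compact (zero_locus p) ->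
  ~ ring_divides 'X p /\ ~ ring_divides 'Y p.
Proof.
move=> /compact_zero_locus_bounded[M MP].
have M1 : ~ (`|M + 1| <= M).
  by move=> h; have := le_trans (ler_norm _) h; rewrite gerDl ler10.
split=> -[q qE].
  by have [|_ /M1] := MP 0 (M + 1) => //; rewrite qE !hornerE.
by have [|/M1] := MP (M + 1) 0 => //; rewrite qE !hornerE.
Qed.

End Compact.

Theorem theorem2 (R : realType) (p : {poly {poly R}})
    (C_compact : compact (zero_locus p)) :
  (~ ring_divides 'X p /\ ~ ring_divides 'Y p) /\
  (forall E : set (plane R),
     is_edge (newton_polygon p) E -> is_outer (newton_polygon p) E ->
     forall u v : int * int, orientation p E u v ->
     forall t : R, root (edge_poly p u v) t -> ~~ odd (mup t (edge_poly p u v))).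
Proof.
split; first exact: compact_not_div.
move=> E Eedge Eouter u v Euv t et; apply/negP => odd_t.
have [pu pv uv _] := Euv.
have e0 : (edge_poly p u v).[0] != 0 by rewrite edge_poly0.
have t0 : t != 0 by apply: contra e0 => /eqP z; rewrite -rootE -z.
have en0 : edge_poly p u v != 0 by apply: contra e0 => /eqP ->; rewrite horner0.
have [t1 [t2 [t1t t2t]]] := odd_root_sign_change en0 t0 odd_t.
have [A [B [AB ABPQ uM face]]] := outer_edge_weight Eedge Eouter Euv.
have [_ _ _ cPQ] := primitive_direction (displacement_neq0 uv).
have t12 : 0 < t1 * t2.
  have tt : 0 < t * t by rewrite -expr2 exprn_even_gt0.
  by rewrite -(pmulr_lgt0 _ tt) mulrACA mulr_gt0.
have [x1 [y1 [x2 [y2 [x12 y12 <- <-]]]]] := monomial_curve_points cPQ t12.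
have := compact_initial_form_sign C_compact AB uM x12 y12.
have [x1n0 x2n0] : x1 != 0 /\ x2 != 0.
  by apply/andP; rewrite -negb_or -mulf_eq0 gt_eqF.
have [y1n0 y2n0] : y1 != 0 /\ y2 != 0.
  by apply/andP; rewrite -negb_or -mulf_eq0 gt_eqF.
rewrite !(initial_form_edge uv ABPQ face)// mulrACA leNgt => /negP n12 e12.
apply: n12; rewrite pmulr_rlt0// mulrACA -!expfzMl.
by rewrite mulr_gt0 ?exprz_gt0.
Qed.
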